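(* Let $J\in\mathbb{R}^{3\times 3}$ be the (symmetric positive definite) inertia matrix of a rigid body, and let $(U,S)$ be any one of the three pairs listed in the context: (I) 3-2-1 Euler angles, (II) 3-1-3 Euler angles, (III) Euler parameters. Write $\partial_i$ for the partial derivative with respect to the $i$-th coordinate of $q=[x_1\ x_2\ x_3]^{\mathrm T}\in U$. Then the following hold. (1) For all $q\in U$ and all $\dot q=[\dot x_1\ \dot x_2\ \dot x_3]^{\mathrm T}\in\mathbb{R}^3$, $$\dot S(q)+[S(q)\dot q]^{\times}S(q)=[\,\partial_1S(q)\dot q\ \ \ \partial_2S(q)\dot q\ \ \ \partial_3S(q)\dot q\,],\qquad\text{where } \dot S(q)=\sum_{i=1}^3\dot x_i\,\partial_iS(q).$$ (2) For all $q\in U$ such that $S(q)$ is nonsingular and all $\dot q\in\mathbb{R}^3$, with $\omega=S(q)\dot q$, $$S(q)^{-\mathrm T}\left(\dot S(q)^{\mathrm T}JS(q)\dot q-\begin{bmatrix}\dot q^{\mathrm T}[\partial_1S(q)]^{\mathrm T}JS(q)\dot q\\ \dot q^{\mathrm T}[\partial_2S(q)]^{\mathrm T}JS(q)\dot q\\ \dot q^{\mathrm T}[\partial_3S(q)]^{\mathrm T}JS(q)\dot q\end{bmatrix}\right)=\omega\times J\omega .$$ (3) Consequently, let $q(\cdot)$ be a twice continuously differentiable curve in $U$, defined on an open interval, along which $S(q(t))$ is nonsingular, let $\tau(\cdot)$ be an $\mathbb{R}^3$-valued function on the same interval, and set $T(q,\dot q)=\tfrac12\dot q^{\mathrm T}S(q)^{\mathrm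 T}JS(q)\dot q$ and $Q=S(q)^{\mathrm T}\tau$. If the Lagrange equation $$\frac{d}{dt}\,\partial_{\dot q}T(q,\dot q)-\partial_qT(q,\dot q)=Q$$ holds along the curve, then $\omega(t)=S(q(t))\dot q(t)$ satisfies Euler's equation $$J\dot\omega+\omega\times J\omega=\tau .$$
   Context: For $x,y\in\mathbb{R}^3$, $x\times y$ is the cross product and $x^\times\in\mathbb{R}^{3\times3}$ is the cross-product matrix, i.e. $x^\times y=x\times y$. $A^{\mathrm T}$ is the transpose and $A^{-\mathrm T}=(A^{\mathrm T})^{-1}$. Partial derivatives $\partial_qT$, $\partial_{\dot q}T$ are column vectors. The vector $\omega=S(q)\dot q$ is the angular velocity of the body (in body-frame components) expressed through generalized coordinates $q$, $T$ is the kinetic energy, $\tau$ is the net torque, and $Q$ is the vector of generalized forces. The three pairs $(U,S)$, where $U\subseteq\mathbb{R}^3$ is open and $S:U\to\mathbb{R}^{3\times3}$: (I) 3-2-1 Euler angles: $U=\mathbb{R}^3$, $q=[\Phi\ \Theta\ \Psi]^{\mathrm T}$ (so $x_1=\Phi$, $x_2=\Theta$, $x_3=\Psi$), $$S(q)=\begin{bmatrix}1&0&-\sin\Theta\\0&\cos\Phi&\sin\Phi\cos\Theta\\0&-\sin\Phi&\cos\Phi\cos\Theta\end{bmatrix}.$$ (II) 3-1-3 Euler angles: $U=\mathbb{R}^3$, $q=[\Psi\ \Theta\ \Phi]^{\mathrm T}$ (so $x_1=\Psi$, $x_2=\Theta$, $x_3=\Phi$), $$S(q)=\begin{bmatrix}0&\cos\Psi&\sin\Psi\sin\Theta\\0&-\sin\Psi&\cos\Psi\sin\Theta\\1&0&\cos\Theta\end{bmatrix}.$$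 (III) Euler parameters (unit quaternions with positive scalar part): $U=\{q\in\mathbb{R}^3: x_1^2+x_2^2+x_3^2<1\}$, $q=[x_1\ x_2\ x_3]^{\mathrm T}$ is the vector part of the unit quaternion, $s=\sqrt{1-x_1^2-x_2^2-x_3^2}>0$ is its scalar part (regarded as a function of $q$), and $$S(q)=2\begin{bmatrix}s+\frac{x_1^2}{s}&x_3+\frac{x_1x_2}{s}&-x_2+\frac{x_1x_3}{s}\\[1ex]-x_3+\frac{x_1x_2}{s}&s+\frac{x_2^2}{s}&x_1+\frac{x_2x_3}{s}\\[1ex]x_2+\frac{x_1x_3}{s}&-x_1+\frac{x_2x_3}{s}&s+\frac{x_3^2}{s}\end{bmatrix}.$$ *)

(* Defs.v *)
From HB Require Import structures.
From mathcomp Require Import all_boot all_order all_algebra.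
From mathcomp Require Import all_classical all_reals all_analysis.
From mathcomp Require Import ring.
Set Implicit Arguments.
Unset Strict Implicit.
Unset Printing Implicit Defensive.
Import Order.TTheory GRing.Theory Num.Theory.
Import numFieldNormedType.Exports.
Local Open Scope classical_set_scope.
Local Open Scope ring_scope.

Section Vectors.
Variable R : realType.

Definition col3 (a b c : R) : 'cV[R]_3 :=
  \col_i [:: a; b; c]`_i.

Definition mx33 (rows : seq (seq R)) : 'M[R]_3 :=
  \matrix_(i, j) (nth [::] rows i)`_j.

Definition crossmul (x y : 'cV[R]_3) : 'cV[R]_3 :=
  let x1 := x 0 0 in let x2 := x 1 0 in let x3 := x 2 0 in
  let y1 := y 0 0 in let y2 := y 1 0 in let y3 := y 2 0 in
  col3 (x2 * y3 - x3 * y2) (x3 * y1 - x1 * y3) (x1 * y2 - x2 * y1).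

Definition crossmx (x : 'cV[R]_3) : 'M[R]_3 :=
  let x1 := x 0 0 in let x2 := x 1 0 in let x3 := x 2 0 in
  mx33 [:: [::   0; - x3;   x2];
           [::  x3;    0; - x1];
           [:: - x2;  x1;    0]].

Lemma mul_crossmx (x y : 'cV[R]_3) : crossmx x *m y = crossmul x y.
Proof.
apply/colP => i; rewrite !mxE !big_ord_recl big_ord0 !mxE.
have -> : lift ord0 ord0 = 1 :> 'I_3 by apply/val_inj.
have -> : lift ord0 (lift ord0 ord0) = 2 :> 'I_3 by apply/val_inj.
have -> : ord0 = 0 :> 'I_3 by apply/val_inj.
by case: i => -[|[|[|//]]] _ /=; ring.
Qed.

Definition posdefmx (A : 'M[R]_3) : Prop :=
  forall x : 'cV[R]_3, x != 0 -> 0 < (x^T *m A *m x) 0 0.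

End Vectors.

(* 'D_v f and [derive1] are total functions: the operators below carry meaning
   only where [f] is derivable. *)
Section Derivatives.
Variable R : realType.

Definition partial (V : normedModType R) (i : 'I_3)
    (f : 'cV[R]_3 -> V) (q : 'cV[R]_3) : V :=
  'D_(delta_mx i 0) f q.

Definition grad (f : 'cV[R]_3 -> R) (q : 'cV[R]_3) : 'cV[R]_3 :=
  \col_i partial i f q.

(* [I] is meant to be open: derivatives are two-sided. *)
Definition C2_on (V : normedModType R) (I : set R) (f : R -> V) : Prop :=
  forall t, I t -> [/\ derivable f t 1, derivable (derive1 f) t 1
                     & {for t, continuous (derive1 (derive1 f))}].

End Derivatives.

(* [Euler321]: q = (Phi, Theta, Psi); [Euler313]: q = (Psi, Theta, Phi);
   [EulerParam]: q = vector part of a unit quaternion with scalar part s > 0. *)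
Inductive attitude := Euler321 | Euler313 | EulerParam.

Section Kinematics.
Variable R : realType.

Definition S321 (q : 'cV[R]_3) : 'M[R]_3 :=
  let Phi := q 0 0 in let Theta := q 1 0 in
  mx33 [:: [:: 1;          0;             - sin Theta];
           [:: 0;    cos Phi;   sin Phi * cos Theta];
           [:: 0;  - sin Phi;   cos Phi * cos Theta]].

Definition S313 (q : 'cV[R]_3) : 'M[R]_3 :=
  let Psi := q 0 0 in let Theta := q 1 0 in
  mx33 [:: [:: 0;    cos Psi;   sin Psi * sin Theta];
           [:: 0;  - sin Psi;   cos Psi * sin Theta];
           [:: 1;          0;               cos Theta]].

Definition Sparam (q : 'cV[R]_3) : 'M[R]_3 :=
  let x1 := q 0 0 in let x2 := q 1 0 in let x3 := q 2 0 in
  let s := Num.sqrt (1 - x1 ^+ 2 - x2 ^+ 2 - x3 ^+ 2) in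
  2 *: mx33
    [:: [::   s + x1 ^+ 2 / s;     x3 + x1 * x2 / s;  - x2 + x1 * x3 / s];
        [:: - x3 + x1 * x2 / s;     s + x2 ^+ 2 / s;     x1 + x2 * x3 / s];
        [::   x2 + x1 * x3 / s;  - x1 + x2 * x3 / s;      s + x3 ^+ 2 / s]].

Definition attU (a : attitude) : set 'cV[R]_3 :=
  match a with
  | Euler321 | Euler313 => setT
  | EulerParam => [set q | q 0 0 ^+ 2 + q 1 0 ^+ 2 + q 2 0 ^+ 2 < 1]
  end.

Definition attS (a : attitude) : 'cV[R]_3 -> 'M[R]_3 :=
  match a with
  | Euler321 => S321
  | Euler313 => S313
  | EulerParam => Sparam
  end.

End Kinematics.

Section Dynamics.
Variable R : realType.
Implicit Types (S : 'cV[R]_3 -> 'M[R]_3) (q v : 'cV[R]_3) (J : 'M[R]_3).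

(* Here and below [v] stands for the velocity, independent of [q]. *)
Definition Sdot S q v : 'M[R]_3 := \sum_(i < 3) v i 0 *: partial i S q.

Definition kinetic J S q v : R :=
  2^-1 * (v^T *m (S q)^T *m J *m S q *m v) 0 0.

Definition Lagrange_eq J S (I : set R) (q tau : R -> 'cV[R]_3) : Prop :=
  let T := kinetic J S in
  let Q t := (S (q t))^T *m tau t in
  forall t, I t ->
    derive1 (fun u => grad (fun v => T (q u) v) (derive1 q u)) t
      - grad (fun p => T p (derive1 q t)) (q t) = Q t.

Definition Euler_eq J (I : set R) (omega tau : R -> 'cV[R]_3) : Prop :=
  forall t, I t -> derivable omega t 1 /\
    J *m derive1 omega t + crossmul (omega t) (J *m omega t) = tau t.

End Dynamics.

(* Main.v *)
Require Import Defs.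
From HB Require Import structures.
From mathcomp Require Import all_boot all_order all_algebra.
From mathcomp Require Import all_classical all_reals all_analysis.
From mathcomp Require Import ring.
Set Implicit Arguments.
Unset Strict Implicit.
Unset Printing Implicit Defensive.
Import Order.TTheory GRing.Theory Num.Theory.
Import numFieldNormedType.Exports.
Local Open Scope classical_set_scope.
Local Open Scope ring_scope.

(** If [O q] is the rotation from body to inertial axes with coordinates [q],
    then [(O q)^T * D_v O q = crossmx (S q *m v)] for every direction [v].
    Equality of the mixed second derivatives of [O] turns this into the
    structure (Maurer-Cartan) equation
      [D_w S *m v - D_v S *m w = (S v) x (S w)],
    a condition on [S] alone ([structure_eq]).  It is checked by direct
    computation for each of the three parametrizations ([structure_eq_321],
    [structure_eq_313], [structure_eq_param]); the trigonometric cases only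
    use [sin ^+ 2 + cos ^+ 2 = 1] and the quaternion case only uses that the
    squares of the four Euler parameters sum to 1.

    The three claims follow from the structure equation without further
    reference to the parametrization.  Taking basis vectors for [w] gives (1)
    column by column ([structure_columns]).  Transposing (1), and using that a
    cross-product matrix is antisymmetric, rewrites the velocity-quadratic
    terms as [S^T (omega x J omega)] ([structure_gyroscopic]), which is (2)
    once [S^T] is inverted.  For (3), the momentum is [S^T J omega], so its
    time derivative is [S'^T J omega + S^T J omega']; subtracting the position
    gradient of the energy leaves [S^T (J omega' + omega x J omega)] by the
    previous identity, and [S^T] cancels against the one in [Q]
    ([Lagrange_Euler]). *)

(** * Differentiation of matrix-valued and scalar functions *)

Section Differentiation.
Variables (R : realType) (V : normedModType R).
Implicit Types (f df g dg : V -> R) (x : V).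

Lemma is_derive_mxP m n (F : V -> 'M[R]_(m, n)) (x v : V) (dF : 'M[R]_(m, n)) :
  is_derive x v F dF <->
  forall i j, is_derive x v (fun p => F p i j) (dF i j).
Proof.
split=> [dFx i j | dFx].
  have dF' : derivable F x v by apply: ex_derive.
  apply: DeriveDef; first by move/derivable_mxP: dF'; apply.
  have := derive_mx dF'; rewrite (derive_val (is_derive := dFx)) => ->.
  by rewrite mxE.
have dF' : derivable F x v by apply/derivable_mxP => i j; apply: ex_derive.
apply: DeriveDef; first by [].
by rewrite derive_mx//; apply/matrixP => i j; rewrite mxE derive_val.
Qed.

Lemma is_derive_mulmx m n p (F : V -> 'M[R]_(m, n)) (G : V -> 'M[R]_(n, p))
    (x v : V) dF dG :
  is_derive x v F dF -> is_derive x v G dG ->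
  is_derive x v (fun y => F y *m G y) (dF *m G x + F x *m dG).
Proof.
move=> /is_derive_mxP dFx /is_derive_mxP dGx; apply/is_derive_mxP => i j.
have -> : (fun y => (F y *m G y) i j) =
    \sum_(k < n) ((fun y => F y i k) * (fun y => G y k j)).
  by apply/funext => y; rewrite fct_sumE mxE.
apply: is_derive_eq.
rewrite !mxE -big_split; apply: eq_bigr => k _ /=.
by rewrite addrC /GRing.scale /= [G x k j * _]mulrC.
Qed.

Lemma is_derive_trmx m n (F : V -> 'M[R]_(m, n)) (x v : V) dF :
  is_derive x v F dF -> is_derive x v (fun y => (F y)^T) dF^T.
Proof.
move=> /is_derive_mxP dFx; apply/is_derive_mxP => i j.
by rewrite mxE; under eq_fun do rewrite mxE; exact: dFx.
Qed.

Lemma is_derive1_diff (c : R -> V) (t : R) (dc : V) :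
  is_derive t 1 c dc -> is_diff t c (fun h => h *: dc).
Proof.
move=> dct; have c1 : derivable c t 1 by apply: ex_derive.
apply: DiffDef; first exact/derivable1_diffP.
by rewrite deriv1E// derive1E derive_val.
Qed.

Lemma is_diff_coord (m n : nat) (x : 'M[R]_(m, n)) i j :
  is_diff x (fun p : 'M[R]_(m, n) => p i j) (fun h => h i j).
Proof.
pose l := (fun N : 'M[R]_(m, n) => N i j : R).
have lL : linear l by move=> k u v; rewrite /l !mxE.
pose lM := GRing.isLinear.Build _ _ _ _ _ lL.
pose L : {linear _ -> _} := HB.pack l lM.
apply: DiffDef; first exact: differentiable_coord.
by rewrite -/l -[l]/(L : _ -> _) diff_lin//; exact: coord_continuous.
Qed.

(** The rules below are stated on applied functions rather than on operations
    between functions, so that they apply by matching the body of a formula. *)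
Lemma is_diff_const (c : R) x : is_diff x (fun _ => c) (fun _ => 0).
Proof. exact: is_diff_cst. Qed.

Lemma is_diff_opp f df x :
  is_diff x f df -> is_diff x (fun p => - f p) (fun h => - df h).
Proof. by move=> dfx; exact: is_diffN. Qed.

Lemma is_diff_add f df g dg x :
  is_diff x f df -> is_diff x g dg ->
  is_diff x (fun p => f p + g p) (fun h => df h + dg h).
Proof. by move=> dfx dgx; exact: is_diffD. Qed.

Lemma is_diff_mul f df g dg x :
  is_diff x f df -> is_diff x g dg ->
  is_diff x (fun p => f p * g p) (fun h => f x * dg h + g x * df h).
Proof. by move=> dfx dgx; exact: is_diffM. Qed.

Lemma is_diff_inv f df x :
  is_diff x f df -> f x != 0 ->
  is_diff x (fun p => (f p)^-1) (fun h => - f x ^- 2 * df h).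
Proof.
move=> dfx fx0; apply: DiffDef; first exact: differentiableV.
by rewrite diffV// diff_val.
Qed.

End Differentiation.

Section ChainRule.
Variables (R : realType) (V : normedModType R).
Implicit Types (f df : V -> R) (x : V).

Lemma is_diff_chain f df (g : R -> R) x (dg : R) :
  is_diff x f df -> is_derive (f x) 1 g dg ->
  is_diff x (fun p => g (f p)) (fun h => dg * df h).
Proof.
move=> dfx /is_derive1_diff dgx.
have H := is_diff_comp dfx dgx; apply: (is_diff_eq H).
by apply/funext => v /=; rewrite /GRing.scale /= mulrC.
Qed.

Lemma is_diff_sin f df x :
  is_diff x f df -> is_diff x (fun p => sin (f p)) (fun h => cos (f x) * df h).
Proof. by move=> dfx; apply: is_diff_chain. Qed.

Lemma is_diff_cos f df x :
  is_diff x f df ->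
  is_diff x (fun p => cos (f p)) (fun h => - sin (f x) * df h).
Proof. by move=> dfx; apply: is_diff_chain. Qed.

End ChainRule.

Ltac solve_diff :=
  repeat first [ exact: is_diff_const | exact: is_diff_coord
               | apply: is_diff_sin | apply: is_diff_cos
               | apply: is_diff_opp | apply: is_diff_mul | apply: is_diff_add ].

(** * Vectors and matrices of size 3 *)

Section Size3.
Variable R : realType.
Implicit Types v w : 'cV[R]_3.

Lemma col3P v w : v 0 0 = w 0 0 -> v 1 0 = w 1 0 -> v 2 0 = w 2 0 -> v = w.
Proof.
move=> e0 e1 e2; apply/colP => -[[|[|[|//]]] lt3].
- by rewrite (_ : Ordinal lt3 = 0)//; apply: val_inj.
- by rewrite (_ : Ordinal lt3 = 1)//; apply: val_inj.
- by rewrite (_ : Ordinal lt3 = 2)//; apply: val_inj.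
Qed.

Lemma tr_crossmx v : (crossmx v)^T = - crossmx v.
Proof.
apply/matrixP => i j; rewrite !mxE.
by case: i => -[|[|[|//]]] ?; case: j => -[|[|[|//]]] ? /=;
  rewrite ?oppr0 ?opprK.
Qed.

Lemma mul_mx33 a b c d e f g h i v :
  mx33 [:: [:: a; b; c]; [:: d; e; f]; [:: g; h; i]] *m v =
  col3 (a * v 0 0 + b * v 1 0 + c * v 2 0) (d * v 0 0 + e * v 1 0 + f * v 2 0)
    (g * v 0 0 + h * v 1 0 + i * v 2 0).
Proof.
have sum3 (F : 'I_3 -> R) : \sum_k F k = F 0 + F 1 + F 2.
  rewrite !big_ord_recr big_ord0 /= add0r.
  by congr (F _ + F _ + F _); apply: val_inj.
by apply: col3P; rewrite [LHS]mxE sum3 !mxE.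
Qed.

Lemma is_diff_mx33 (q : 'cV[R]_3) (F dF : 'cV[R]_3 -> seq (seq R)) :
  (forall i j : nat, (i < 3)%N -> (j < 3)%N ->
    is_diff q (fun p => (nth [::] (F p) i)`_j)
      (fun h => (nth [::] (dF h) i)`_j)) ->
  forall i j, is_diff q (fun p => mx33 (F p) i j) (fun h => mx33 (dF h) i j).
Proof.
move=> dFq i j; under eq_fun do rewrite mxE.
rewrite [X in is_diff _ _ X](_ : _ = fun h => (nth [::] (dF h) i)`_j).
  exact: dFq.
by apply/funext => h; rewrite mxE.
Qed.

End Size3.

(** * The structure equation and its consequences *)

Section StructureEquation.
Variable R : realType.
Implicit Types (S : 'cV[R]_3 -> 'M[R]_3) (q v w : 'cV[R]_3).

(** [dS v] is the derivative at [q] of [S] in the direction [v]. Frechet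
    differentiability is required, and not only partial derivatives, because
    [S] has to be differentiated along curves; it is stated entrywise. *)
Definition structure_eq S q (dS : 'cV[R]_3 -> 'M[R]_3) :=
  (forall i j, is_diff q (fun p => S p i j) (fun v => dS v i j)) /\
  (forall v w, dS w *m v - dS v *m w = crossmul (S q *m v) (S q *m w)).

Section AtPoint.
Variables (S : 'cV[R]_3 -> 'M[R]_3) (q : 'cV[R]_3) (dS : 'cV[R]_3 -> 'M[R]_3).
Hypothesis Sq : structure_eq S q dS.

Lemma structure_derive v : is_derive q v S (dS v).
Proof.
apply/is_derive_mxP => i j; have dSij := Sq.1 i j.
apply: DeriveDef; first exact: diff_derivable.
by rewrite deriveE// diff_val.
Qed.

Lemma structure_partial i : partial i S q = dS (delta_mx i 0).
Proof.
by rewrite /partial; have H := structure_derive (delta_mx i 0); rewrite derive_val.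
Qed.

Lemma structure_Sdot v : Sdot S q v = dS v.
Proof.
apply/matrixP => i j; have dSij := Sq.1 i j.
rewrite /Sdot summxE [RHS](_ : _ = 'd (fun p => S p i j) q v); last first.
  by rewrite diff_val.
have {2}-> : v = \sum_(i < 3) v i 0 *: delta_mx i 0.
  rewrite {1}[v]matrix_sum_delta.
  by apply: eq_bigr => k _; rewrite big_ord1.
rewrite linear_sum; apply: eq_bigr => k _.
by rewrite linearZ mxE structure_partial diff_val.
Qed.

Lemma structure_curve (c : R -> 'cV[R]_3) t (dc : 'cV[R]_3) :
  c t = q -> is_derive t 1 c dc -> is_derive t 1 (fun u => S (c u)) (dS dc).
Proof.
move=> ct /is_derive1_diff dct; apply/is_derive_mxP => i j.
have dSij := Sq.1 i j; rewrite -ct in dSij.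
have H := is_diff_comp dct dSij.
apply: DeriveDef; first exact: diff_derivable.
by rewrite deriveE// diff_val /= scale1r.
Qed.

(** Column [j] is the structure equation with the [j]-th basis vector as second
    direction. *)
Lemma structure_columns v :
  Sdot S q v + crossmx (S q *m v) *m S q
  = \matrix_(i < 3, j < 3) (partial j S q *m v) i 0.
Proof.
apply/matrixP => i j; rewrite [RHS]mxE structure_partial structure_Sdot.
have -> : dS (delta_mx j 0) *m v =
    (dS v + crossmx (S q *m v) *m S q) *m delta_mx j 0.
  by rewrite mulmxDl -mulmxA mul_crossmx -Sq.2 addrC subrK.
by rewrite -colE [RHS]mxE.
Qed.

(** With [D] the right-hand side of [structure_columns], the left-hand side is
    [(Sdot - D)^T J omega = - (crossmx omega *m S)^T J omega], and the sign is
    absorbed by the antisymmetry of [crossmx omega]. *)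
Lemma structure_gyroscopic (J : 'M[R]_3) v :
  (Sdot S q v)^T *m J *m S q *m v
    - \col_(i < 3) (v^T *m (partial i S q)^T *m J *m S q *m v) 0 0
  = (S q)^T *m crossmul (S q *m v) (J *m (S q *m v)).
Proof.
set x := J *m (S q *m v).
set D := \matrix_(i < 3, j < 3) (partial j S q *m v) i 0.
have -> : \col_(i < 3) (v^T *m (partial i S q)^T *m J *m S q *m v) 0 0
    = D^T *m x.
  apply/colP => i; rewrite mxE -trmx_mul -!mulmxA -/x !mxE.
  by apply: eq_bigr => k _; rewrite !mxE.
rewrite -!mulmxA -/x -mulmxBl -linearB /D -structure_columns /=.
rewrite opprD addNKr linearN /= trmx_mul tr_crossmx mulmxN opprK.
by rewrite -mulmxA mul_crossmx.
Qed.

End AtPoint.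

(** * Gradients of the kinetic energy, and Lagrange's equation *)

Section Energy.
Variable J : 'M[R]_3.
Hypothesis Jsym : J^T = J.

(** The energy depends on position and velocity only through the angular
    velocity [om], so this covers the gradients in both variables. *)
Lemma is_derive_energy (V : normedModType R) (om : V -> 'cV[R]_3) (x e : V) dom :
  is_derive x e om dom ->
  is_derive x e (fun p => 2^-1 * ((om p)^T *m (J *m om p)) 0 0)
    ((dom^T *m (J *m om x)) 0 0).
Proof.
move=> domx.
have dJ : is_derive x e (fun _ : V => J) 0 by exact: is_derive_cst.
have /is_derive_mxP/(_ 0 0) H :=
  is_derive_mulmx (is_derive_trmx domx) (is_derive_mulmx dJ domx).
have -> : (fun p => 2^-1 * ((om p)^T *m (J *m om p)) 0 0) =
  2^-1 *: (fun p => ((om p)^T *m (J *m om p)) 0 0) by [].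
apply: is_derive_eq.
(* The two terms of the product rule are 1 x 1 matrices transposed to each
   other, since J is symmetric; this cancels the factor 1/2. *)
have -> : (om x)^T *m (0 *m om x + J *m dom) = (dom^T *m (J *m om x))^T.
  by rewrite mul0mx add0r !trmx_mul Jsym trmxK mulmxA.
rewrite [X in _ *: X]mxE [X in _ + X]mxE /GRing.scale /=.
by field.
Qed.

Lemma kineticE S q v :
  kinetic J S q v = 2^-1 * ((S q *m v)^T *m (J *m (S q *m v))) 0 0.
Proof. by rewrite /kinetic trmx_mul !mulmxA. Qed.

Lemma grad_velocity S q v :
  grad (fun w => kinetic J S q w) v = (S q)^T *m (J *m (S q *m v)).
Proof.
apply/colP => i; rewrite mxE /partial.
under eq_fun do rewrite kineticE.
have dS : is_derive v (delta_mx i 0 : 'cV[R]_3) (fun _ : 'cV[R]_3 => S q) 0.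
  exact: is_derive_cst.
have dw : is_derive v (delta_mx i 0 : 'cV[R]_3) (fun w : 'cV[R]_3 => w)
  (delta_mx i 0) by exact: is_derive_id.
have H := is_derive_energy (is_derive_mulmx dS dw).
rewrite derive_val mul0mx add0r trmx_mul -mulmxA trmx_delta.
by rewrite -rowE mxE.
Qed.

Lemma grad_position S q dS v : structure_eq S q dS ->
  grad (fun p => kinetic J S p v) q
  = \col_(i < 3) (v^T *m (partial i S q)^T *m J *m S q *m v) 0 0.
Proof.
move=> Sq; apply/colP => i; rewrite [LHS]mxE [RHS]mxE {1}/partial.
under eq_fun do rewrite kineticE.
have dSi := structure_derive Sq (delta_mx i 0).
have dv : is_derive q (delta_mx i 0 : 'cV[R]_3) (fun _ : 'cV[R]_3 => v) 0.
  exact: is_derive_cst.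
have H := is_derive_energy (is_derive_mulmx dSi dv).
rewrite derive_val mulmx0 addr0 trmx_mul (structure_partial Sq).
by rewrite !mulmxA.
Qed.

(** The momentum [S^T J omega] differentiates to
    [S'^T J omega + S^T J omega']; combined with the position gradient, the
    first term becomes [S^T (omega x J omega)] by [structure_gyroscopic], so
    that [S^T] factors out of the whole equation. *)
Lemma Lagrange_Euler S (I : set R) (q tau : R -> 'cV[R]_3) :
  C2_on I q ->
  (forall t, I t -> S (q t) \in unitmx /\ exists dS, structure_eq S (q t) dS) ->
  Lagrange_eq J S I q tau ->
  Euler_eq J I (fun t => S (q t) *m derive1 q t) tau.
Proof.
move=> qC2 Sq lagr t It.
have [Su [dS Sqt]] := Sq t It; have [dq ddq _] := qC2 t It.
have Dq : is_derive t 1 q (derive1 q t).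
  by rewrite derive1E; exact: (derivableP dq).
have DDq : is_derive t 1 (derive1 q) (derive1 (derive1 q) t).
  by rewrite [X in is_derive _ _ _ X]derive1E; exact: (derivableP ddq).
have DS := structure_curve Sqt erefl Dq.
have Dom := is_derive_mulmx DS DDq.
set dom := (_ + _) in Dom.
split; first by apply: ex_derive.
rewrite derive1E derive_val.
have dJ : is_derive t 1 (fun _ : R => J) 0 by exact: is_derive_cst.
have Dp := is_derive_mulmx (is_derive_trmx DS) (is_derive_mulmx dJ Dom).
have := lagr t It => /=.
under eq_fun do rewrite grad_velocity.
rewrite (grad_position _ Sqt) derive1E derive_val mul0mx add0r.
rewrite addrAC -(structure_Sdot Sqt) !mulmxA.
rewrite (structure_gyroscopic Sqt) -!mulmxA -mulmxDr addrC.
have STu : (S (q t))^T \in unitmx by rewrite unitmx_tr.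
by move=> /(can_inj (mulKmx STu)).
Qed.

End Energy.
End StructureEquation.

(** * The structure equation for Euler angles *)

Section EulerAngles.
Variable R : realType.
Implicit Types (q v w : 'cV[R]_3).

Let sin2E (x : R) : sin x ^+ 2 = 1 - cos x ^+ 2.
Proof. by rewrite -(cos2Dsin2 x) addrC addKr. Qed.

Definition dS321 q v : 'M[R]_3 :=
  let sP := sin (q 0 0) in let cP := cos (q 0 0) in
  let sT := sin (q 1 0) in let cT := cos (q 1 0) in
  let dP := v 0 0 in let dT := v 1 0 in
  mx33 [:: [:: 0;           0;                          - (cT * dT)];
           [:: 0;   - sP * dP;   sP * (- sT * dT) + cT * (cP * dP)];
           [:: 0; - (cP * dP); cP * (- sT * dT) + cT * (- sP * dP)]].

Definition dS313 q v : 'M[R]_3 :=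
  let sP := sin (q 0 0) in let cP := cos (q 0 0) in
  let sT := sin (q 1 0) in let cT := cos (q 1 0) in
  let dP := v 0 0 in let dT := v 1 0 in
  mx33 [:: [:: 0;   - sP * dP;   sP * (cT * dT) + sT * (cP * dP)];
           [:: 0; - (cP * dP); cP * (cT * dT) + sT * (- sP * dP)];
           [:: 0;           0;                         - sT * dT]].

Lemma structure_eq_321 q : structure_eq (@S321 R) q (dS321 q).
Proof.
split.
  apply: is_diff_mx33.
  by move=> [|[|[|//]]] [|[|[|//]]] _ _ /=; solve_diff.
move=> v w; rewrite /S321 !mul_mx33.
have sc := sin2E (q 0 0).
by apply: col3P; rewrite !mxE /=; ring: sc.
Qed.

Lemma structure_eq_313 q : structure_eq (@S313 R) q (dS313 q).
Proof.
split.
  apply: is_diff_mx33.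
  by move=> [|[|[|//]]] [|[|[|//]]] _ _ /=; solve_diff.
move=> v w; rewrite /S313 !mul_mx33.
have sc := sin2E (q 0 0).
by apply: col3P; rewrite !mxE /=; ring: sc.
Qed.

End EulerAngles.

(** * The structure equation for Euler parameters *)

Section EulerParameters.
Variable R : realType.
Implicit Types (q v w : 'cV[R]_3).

Definition scalar_part q : R :=
  Num.sqrt (1 - q 0 0 ^+ 2 - q 1 0 ^+ 2 - q 2 0 ^+ 2).

Definition dscalar_part q v : R :=
  - (q 0 0 * v 0 0 + q 1 0 * v 1 0 + q 2 0 * v 2 0) / scalar_part q.

Lemma scalar_part_sqr_gt0 q : attU EulerParam q ->
  0 < 1 - q 0 0 ^+ 2 - q 1 0 ^+ 2 - q 2 0 ^+ 2.
Proof. by move=> q1; rewrite -!addrA -!opprD subr_gt0 addrA. Qed.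

Lemma scalar_part_neq0 q : attU EulerParam q -> scalar_part q != 0.
Proof. by move=> q1; rewrite gt_eqF// sqrtr_gt0 scalar_part_sqr_gt0. Qed.

Lemma is_diff_scalar_part q : attU EulerParam q ->
  is_diff q scalar_part (dscalar_part q).
Proof.
move=> q1; have s0 := scalar_part_sqr_gt0 q1; have s1 := scalar_part_neq0 q1.
have ds : is_diff q
    (fun p : 'cV[R]_3 => 1 - p 0 0 * p 0 0 - p 1 0 * p 1 0 - p 2 0 * p 2 0)
    (fun h => - 2 * (q 0 0 * h 0 0 + q 1 0 * h 1 0 + q 2 0 * h 2 0)).
  apply: is_diff_eq; first by solve_diff.
  apply/funext => h /=.
  by rewrite [(0 : 'cV[R]_3 -> R) h](_ : _ = 0)//; ring.
have := is_diff_chain ds (is_derive1_sqrt s0).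
move=> /is_diff_eq; apply; apply/funext => h.
rewrite /dscalar_part -/(scalar_part q).
by field.
Qed.

Lemma is_diff_quot q (f df g dg : 'cV[R]_3 -> R) : attU EulerParam q ->
  is_diff q f df -> is_diff q g dg ->
  is_diff q (fun p => f p * g p / scalar_part p)
    (fun v => (df v * g q + f q * dg v) / scalar_part q
       - f q * g q * dscalar_part q v / scalar_part q ^+ 2).
Proof.
move=> q1 dfq dgq; have ds := is_diff_scalar_part q1.
have s0 := scalar_part_neq0 q1.
apply: is_diff_eq.
  exact: is_diff_mul (is_diff_mul dfq dgq) (is_diff_inv ds s0).
by apply/funext => v /=; field.
Qed.

Definition dSparam q v : 'M[R]_3 :=
  let x1 := q 0 0 in let x2 := q 1 0 in let x3 := q 2 0 in
  let v1 := v 0 0 in let v2 := v 1 0 in let v3 := v 2 0 in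
  let s := scalar_part q in let ds := dscalar_part q v in
  let dq x dx y dy := (dx * y + x * dy) / s - x * y * ds / s ^+ 2 in
  2 *: mx33
    [:: [::   ds + dq x1 v1 x1 v1;   v3 + dq x1 v1 x2 v2; - v2 + dq x1 v1 x3 v3];
        [:: - v3 + dq x1 v1 x2 v2;   ds + dq x2 v2 x2 v2;   v1 + dq x2 v2 x3 v3];
        [::   v2 + dq x1 v1 x3 v3; - v1 + dq x2 v2 x3 v3;   ds + dq x3 v3 x3 v3]].

Lemma structure_eq_param q : attU EulerParam q ->
  structure_eq (@Sparam R) q (dSparam q).
Proof.
move=> q1; have ds := is_diff_scalar_part q1; have s0 := scalar_part_neq0 q1.
split.
  move=> i j; rewrite /Sparam /dSparam /=.
  under eq_fun do rewrite mxE.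
  under [X in is_diff _ _ X]eq_fun do rewrite mxE.
  apply: is_diffZ; move: i j; apply: is_diff_mx33.
  move=> [|[|[|//]]] [|[|[|//]]] _ _ /=; apply: is_diff_add;
    by [exact: ds | apply: is_diff_quot q1 _ _; exact: is_diff_coord
       | solve_diff].
move=> v w; rewrite /Sparam -/(scalar_part q) /dSparam -!scalemxAl !mul_mx33.
rewrite /dscalar_part.
have ssq : scalar_part q ^+ 2 = 1 - q 0 0 ^+ 2 - q 1 0 ^+ 2 - q 2 0 ^+ 2.
  by rewrite sqr_sqrtr// ltW// scalar_part_sqr_gt0.
move: (scalar_part q) s0 ssq => s s0 ssq.
(* The unit-norm relation is solved for a coordinate and not for s, because
   powers of s also occur in the denominators. *)
have x3sq : q 2 0 ^+ 2 = 1 - q 0 0 ^+ 2 - q 1 0 ^+ 2 - s ^+ 2.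
  by rewrite ssq; ring.
by apply: col3P; rewrite !mxE /=; field: x3sq.
Qed.

End EulerParameters.

Lemma attS_structure_eq (R : realType) (a : attitude) (q : 'cV[R]_3) :
  attU a q -> exists dS, structure_eq (attS a) q dS.
Proof.
case: a => qU.
- by exists (dS321 q); exact: structure_eq_321.
- by exists (dS313 q); exact: structure_eq_313.
- by exists (dSparam q); exact: structure_eq_param.
Qed.

(** * Euler's equation from Lagrange's equation *)

Theorem mainTheorem1 (R : realType) (J : 'M[R]_3)
    (Jsym : J^T = J) (Jpos : posdefmx J) (a : attitude) :
  let U : set 'cV[R]_3 := attU a in
  let S : 'cV[R]_3 -> 'M[R]_3 := attS a in
  [/\ (forall q v : 'cV[R]_3, U q ->
         Sdot S q v + crossmx (S q *m v) *m S q
         = \matrix_(i < 3, j < 3) (partial j S q *m v) i 0),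
      (forall q v : 'cV[R]_3, U q -> S q \in unitmx ->
         let omega := S q *m v in
         invmx (S q)^T *m
           ((Sdot S q v)^T *m J *m S q *m v
            - \col_(i < 3) (v^T *m (partial i S q)^T *m J *m S q *m v) 0 0)
         = crossmul omega (J *m omega))
    & (forall (I : set R) (q tau : R -> 'cV[R]_3),
         open I -> is_interval I ->
         C2_on I q ->
         (forall t, I t -> U (q t) /\ S (q t) \in unitmx) ->
         Lagrange_eq J S I q tau ->
         Euler_eq J I (fun t => S (q t) *m derive1 q t) tau)].
Proof.
move=> U S; split.
- move=> q v /attS_structure_eq[dS Sq].
  exact: structure_columns Sq v.
- move=> q v /attS_structure_eq[dS Sq] Su /=.
  by rewrite (structure_gyroscopic Sq) mulKmx// unitmx_tr.
- move=> I q tau _ _ qC2 Sq; apply: Lagrange_Euler => // t /Sq[Uq Su].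
  by split=> //; exact: attS_structure_eq.
Qed.
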